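(* Let $A,B,C\in\mathbb{C}^{n\times n}$ satisfy $ABA=ACA$. Then $AC\sim BA$ if and only if $\operatorname{rank}\big((AC)^k\big)=\operatorname{rank}\big((BA)^k\big)$ for all $k=1,2,\ldots$.
   Context: For $X,Y\in\mathbb{C}^{n\times n}$, $X\sim Y$ means that $X$ and $Y$ are similar: $X=S^{-1}YS$ for some invertible $S\in\mathbb{C}^{n\times n}$. *)

(* Defs.v *)
From HB Require Import structures.
From mathcomp Require Export all_boot all_order all_algebra.
From mathcomp Require Export reals complex.

(* Main.v *)
(** Put X = AC and Y = BA, acting on row vectors. Then XA = AY, and if the ranks
    of the powers of X are stationary from k on, A is injective on the row space
    of X^k and embeds it, compatibly with the actions, into the row space of Y^k.
    Such an embedding S is extended from im X^(k+1) to im X^k, down to k = 0: a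
    first solution of G Y = X S is corrected by a map into ker Y that agrees with
    S - G on im X^(k+1) and is an isomorphism of im X^k ∩ ker X onto
    im Y^k ∩ ker Y, two spaces of equal dimension by the rank hypothesis. *)
Require Import Defs.

Set Implicit Arguments.
Unset Strict Implicit.
Unset Printing Implicit Defensive.
Import GRing.Theory.
Local Open Scope ring_scope.

Section Extension.
Variable F : fieldType.

Lemma mulmx_factor m n p (M : 'M[F]_(m, n)) (P : 'M[F]_(m, p)) :
  (kermx M <= kermx P)%MS -> exists2 h : 'M_(n, p), M *m h = P & (h <= P)%MS.
Proof.
move=> kerMP; exists (pinvmx M *m P); last exact: submxMl.
apply/eqP; rewrite mulmxA -subr_eq0 -{2}[P]mul1mx -mulmxBl -sub_kermx.
apply: submx_trans kerMP.
by rewrite sub_kermx mulmxBl mul1mx mulmxKpV ?submx_refl// subrr.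
Qed.

(** A relation between the rows of [U] and those of [W] is a vector of [U :&: W], where [f] and [g]
    agree, so prescribing both values is consistent. *)
Lemma glue_mulmx m1 m2 n p q (U : 'M[F]_(m1, n)) (W : 'M[F]_(m2, n))
    (Z : 'M[F]_(q, p)) (f g : 'M[F]_(n, p)) :
    (U :&: W <= kermx (f - g))%MS ->
    (U *m f <= Z)%MS -> (W *m g <= Z)%MS ->
  exists h : 'M_(n, p), [/\ U *m h = U *m f, W *m h = W *m g & (h <= Z)%MS].
Proof.
move=> fg UfZ WgZ.
have [|h] := @mulmx_factor _ _ _ (col_mx U W) (col_mx (U *m f) (W *m g)).
  apply/rV_subP=> u; rewrite !sub_kermx -[u]hsubmxK !mul_row_col.
  rewrite addr_eq0 => /eqP uUW; rewrite !mulmxA uUW mulNmx addrC -mulmxBr.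
  rewrite -oppr_eq0 -mulmxN opprB -sub_kermx (submx_trans _ fg)//.
  by rewrite sub_capmx submxMl -(opprK (_ *m W)) -uUW eqmx_opp submxMl.
rewrite mul_col_mx => /eq_col_mx[hU hW] hle; exists h; split=> //.
by rewrite (submx_trans hle)// col_mx_sub UfZ.
Qed.

Lemma eq_rank_eqmx n (D E : 'M[F]_n) :
  \rank D = \rank E -> exists g : 'M_n, (D *m g :=: E)%MS.
Proof.
(* [g] carries the extended row basis of [D] to that of [E]. *)
move=> rDE; exists (invmx (row_ebase D) *m row_ebase E).
rewrite mulmxA -{1}(mulmx_ebase D) mulmxK ?row_ebase_unit//.
rewrite rDE -mulmxA.
apply: eqmx_trans (eqmxMfull _ _) _.
  by rewrite row_full_unit col_ebase_unit.
apply: eqmx_sym; rewrite -{1}(mulmx_ebase E) -mulmxA.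
by apply: eqmxMfull; rewrite row_full_unit col_ebase_unit.
Qed.

(** The complements of [I] in [K] and of [I *m f] in [L] have equal rank; [f] is glued with a map of
    one onto the other. *)
Lemma extend_eqmx n (I K L f : 'M[F]_n) :
    (I <= K)%MS -> (I *m f <= L)%MS -> \rank (I *m f) = \rank I ->
    \rank K = \rank L ->
  exists g : 'M_n, I *m g = I *m f /\ (K *m g :=: L)%MS.
Proof.
move=> IK IfL rIf rKL.
have rD : \rank (K :\: I)%MS = \rank (L :\: I *m f)%MS.
  have := mxrank_cap_compl L (I *m f); rewrite (capmx_idPr IfL) rIf -rKL.
  by rewrite -(mxrank_cap_compl K I) (capmx_idPr IK) => /addnI.
have [g Dg] := eq_rank_eqmx rD.
have [|||h [hI hD _]] := @glue_mulmx _ _ _ _ _ I (K :\: I)%MS 1%:M f g.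
- by rewrite capmxC capmx_diff sub0mx.
- exact: submx1.
- exact: submx1.
exists h; split=> //.
have sumD (M N : 'M[F]_n) : (N <= M)%MS -> (M :=: N + (M :\: N))%MS.
  move=> NM; apply: eqmx_sym; apply: eqmx_trans (addsmx_diff_cap_eq M N).
  rewrite addsmxC; apply: adds_eqmx (eqmx_refl _) _.
  exact/eqmx_sym/capmx_idPr.
apply: eqmx_trans (eqmxMr h (sumD _ _ IK)) _.
apply: eqmx_trans (addsmxMr _ _ h) _.
apply: eqmx_trans (eqmx_sym (sumD _ _ IfL)).
by rewrite hI hD; apply: adds_eqmx Dg.
Qed.
End Extension.

Section Intertwine.
Variables (F : fieldType) (n : nat).
Implicit Types X Y S T : 'M[F]_n.

(** At [k = 0] this makes [S] invertible with [X *m S = S *m Y], which is a similarity. *)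
Definition embeds X Y k S :=
  [/\ X ^+ k *m (X *m S) = X ^+ k *m (S *m Y), (X ^+ k *m S <= Y ^+ k)%MS
    & (X ^+ k :&: kermx S)%MS = 0].

Lemma embeds_pred X Y k S :
    \rank (X ^+ k) = \rank (Y ^+ k) -> \rank (X ^+ k.+1) = \rank (Y ^+ k.+1) ->
  embeds X Y k.+1 S -> exists T, embeds X Y k T.
Proof.
move=> rk rk1 [XS SY injS].
pose K := (X ^+ k :&: kermx X)%MS; pose L := (Y ^+ k :&: kermx Y)%MS.
have X1 : X ^+ k.+1 = X ^+ k *m X by rewrite exprSr.
have Y1 : Y ^+ k.+1 = Y ^+ k *m Y by rewrite exprSr.
have X1k : (X ^+ k.+1 <= X ^+ k)%MS by rewrite exprS submxMl.
have Y1k : (Y ^+ k.+1 <= Y ^+ k)%MS by rewrite exprS submxMl.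
(* Rank-nullity for [X] on the image of [X ^+ k], and likewise for [Y]. *)
have rKL : \rank K = \rank L.
  apply/eqP; rewrite -(eqn_add2l (\rank (X ^+ k.+1))) {2}rk1.
  by rewrite X1 Y1 !mxrank_mul_ker rk.
pose I := (X ^+ k.+1 :&: K)%MS.
have IX : I *m X = 0.
  by apply/eqP; rewrite -sub_kermx (submx_trans (capmxSr _ _))// capmxSr.
have XSsub m (v : 'M_(m, n)) : (v <= X ^+ k.+1)%MS -> v *m X *m S = v *m S *m Y.
  by case/submxP=> w ->; rewrite -!(mulmxA w) -!mulmxA XS.
have IL : (I *m S <= L)%MS.
  rewrite sub_capmx (submx_trans (submxMr _ (capmxSl _ _)))/=; last first.
    exact: submx_trans Y1k.
  by rewrite sub_kermx -XSsub ?capmxSl// IX mul0mx.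
have rI : \rank (I *m S) = \rank I.
  rewrite -[RHS](mxrank_mul_ker I S) (_ : (I :&: kermx S)%MS = 0).
    by rewrite mxrank0 addn0.
  by apply/eqP; rewrite -submx0 -injS capmxS// capmxSl.
have [J [IJ KJ]] := extend_eqmx (capmxSr _ _) IL rI rKL.
(* [G] solves [G Y = X S] on the row space of [X ^+ k]; the correction [H] has
   values in [kermx Y], and makes [G + H] agree with [S] on [X ^+ k.+1] and
   with [J] on [K]. *)
pose G := X *m S *m pinvmx (Y ^+ k.+1) *m Y ^+ k.
have GY : X ^+ k *m G *m Y = X ^+ k *m (X *m S).
  rewrite -[LHS]mulmxA -(mulmxA _ _ Y) -Y1 mulmxA mulmxA mulmxKpV ?mulmxA//.
  by rewrite -X1.
have GYsub m (v : 'M_(m, n)) : (v <= X ^+ k)%MS -> v *m G *m Y = v *m X *m S.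
  by case/submxP=> w ->; rewrite -!(mulmxA w) GY !mulmxA.
have KG : K *m G = 0.
  by rewrite /G !mulmxA (sub_kermxP (capmxSr _ _)) !mul0mx.
have [|||H [HX HK HL]] :=
    @glue_mulmx _ _ _ _ _ _ (X ^+ k.+1) K L (S - G) J.
- rewrite -/I sub_kermx !mulmxBr IJ.
  have -> : I *m G = 0.
    have /submxP[w ->] : (I <= K)%MS by exact: capmxSr.
    by rewrite -mulmxA KG mulmx0.
  by rewrite subr0 subrr.
(* On the image of [X ^+ k.+1], [S] and [G] both land in that of [Y ^+ k], and following either by
   [Y] gives [X *m S]. *)
- rewrite mulmxBr sub_capmx; apply/andP; split.
    by rewrite addmx_sub ?(submx_trans SY)// eqmx_opp /G mulmxA submxMl.
  by rewrite sub_kermx mulmxBl -XSsub// GYsub// subrr.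
- by rewrite KJ.
have HY m (v : 'M_(m, n)) : v *m H *m Y = 0.
  apply/eqP; rewrite -sub_kermx (submx_trans (submxMl _ _))//.
  by rewrite (submx_trans HL)// capmxSr.
have TS : X ^+ k.+1 *m (G + H) = X ^+ k.+1 *m S.
  by rewrite mulmxDr HX mulmxBr addrC subrK.
have TY m (v : 'M_(m, n)) :
  (v <= X ^+ k)%MS -> v *m (G + H) *m Y = v *m X *m S.
  by move=> vX; rewrite mulmxDr mulmxDl HY addr0 GYsub.
exists (G + H); split.
- by rewrite !mulmxA TY// -X1 TS.
- rewrite mulmxDr addmx_sub//; first by rewrite /G mulmxA submxMl.
  by rewrite (submx_trans (submxMl _ _))// (submx_trans HL)// capmxSl.
(* If [G + H] kills [v], then [S] kills [v *m X], so [v *m X = 0] and [v] lies in [K], where [G + H]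
   is the injective [J]. *)
apply/eqP; rewrite -submx0; apply/rV_subP=> v.
rewrite sub_capmx => /andP[vX /sub_kermxP vT].
have vXS : v *m X *m S = 0 by rewrite -TY// vT mul0mx.
have vX0 : v *m X = 0.
  apply/eqP; rewrite -submx0 -injS sub_capmx sub_kermx vXS eqxx andbT.
  by rewrite X1 submxMr.
have /submxP[w vK] : (v <= K)%MS by rewrite sub_capmx vX sub_kermx vX0 eqxx.
have injJ : (K :&: kermx J)%MS = 0.
  apply/eqP; rewrite -mxrank_eq0 -(eqn_add2l (\rank (K *m J))).
  by rewrite mxrank_mul_ker addn0 KJ rKL.
rewrite -injJ sub_capmx {1}vK submxMl sub_kermx -vT mulmxDr.
by rewrite vK -!mulmxA KG mulmx0 add0r HK eqxx.
Qed.

Lemma embeds_simmx X Y k S :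
    (forall j, (0 < j)%N -> \rank (X ^+ j) = \rank (Y ^+ j)) ->
  embeds X Y k S -> X ~_{in unitmx} Y.
Proof.
move=> rXY; elim: k S => [|k IH] S embS.
  case: embS; rewrite expr0 !mul1mx => XS _ injS.
  have Su : S \in unitmx.
    by rewrite -row_free_unit -kermx_eq0 -submx0 -injS sub_capmx submx1 /=.
  exists (invmx S); first by rewrite unitmx_inv.
  apply/simmxP; first by rewrite unitmx_inv.
  by rewrite -[LHS](mulmxK Su) -(mulmxA _ X) XS mulKmx.
suff [T] : exists T, embeds X Y k T by exact: IH.
apply: embeds_pred embS; last exact: rXY.
(* The hypothesis omits exponent 0, where both powers are the identity. *)
by case: k {IH} => [|k]; [rewrite !expr0 | exact: rXY].
Qed.

Lemma rank_expr_stable X : exists k, \rank (X ^+ k.+1) = \rank (X ^+ k).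
Proof.
(* Induction on a bound for the rank: each strict drop lowers it. *)
suff H r k : (\rank (X ^+ k) <= r)%N ->
    exists j, \rank (X ^+ j.+1) = \rank (X ^+ j) by exact: (H _ 0%N (leqnn _)).
elim: r k => [|r IH] k rk.
  exists k; apply/eqP; rewrite eqn_leq {1}exprS mxrankM_maxr /=.
  exact: leq_trans rk _.
have: (\rank (X ^+ k.+1) <= \rank (X ^+ k))%N by rewrite exprS mxrankM_maxr.
rewrite leq_eqVlt => /orP[/eqP|lt]; first by exists k.
by apply: (IH k.+1); rewrite -ltnS (leq_trans lt).
Qed.

Lemma simmx_rank_expr X Y k :
  X ~_{in unitmx} Y -> \rank (X ^+ k) = \rank (Y ^+ k).
Proof.
case=> S Su /(simmxP Su) SX.
have SXk : S *m X ^+ k = Y ^+ k *m S.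
  elim: k => [|k IH]; first by rewrite !expr0 mulmx1 mul1mx.
  by rewrite !exprSr mulmxA IH -mulmxA SX mulmxA.
rewrite -(mxrankMfree (Y ^+ k) (_ : row_free S)) ?row_free_unit// -SXk.
by rewrite eqmxMfull ?row_full_unit.
Qed.

Lemma embeds_mulmx A B C k :
    A *m B *m A = A *m C *m A ->
    \rank ((A *m C) ^+ k.+1) = \rank ((A *m C) ^+ k) ->
  embeds (A *m C) (B *m A) k A.
Proof.
move=> hABA rk; have XA : A *m C *m A = A *m (B *m A) by rewrite mulmxA hABA.
have XkA : (A *m C) ^+ k *m A = A *m (B *m A) ^+ k.
  elim: k {rk} => [|k IH]; first by rewrite !expr0 mulmx1 mul1mx.
  by rewrite !exprSr -mulmxA XA mulmxA IH -mulmxA.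
split; rewrite ?XA// ?XkA ?submxMl//.
(* The next power factors through [(A *m C) ^+ k *m A], so [A] loses no rank on the image of
   [(A *m C) ^+ k]. *)
apply/eqP; rewrite -mxrank_eq0 -leqn0 -(leq_add2l (\rank ((A *m C) ^+ k *m A))).
rewrite mxrank_mul_ker addn0 -{1}rk exprSr -mulmxE mulmxA.
exact: mxrankM_maxl.
Qed.
End Intertwine.

(* [X ~_{in unitmx} Y] says that [conjmx S X == Y] for some invertible [S];
   by [simmxP] this is [S *m X = Y *m S], i.e. X = S^-1 Y S. *)
Theorem corollary2p9 (R : realType) (n : nat) (A B C : 'M[R[i]]_n)
    (hABA : A *m B *m A = A *m C *m A) :
  (A *m C) ~_{in unitmx} (B *m A) <->
  (forall k : nat, (0 < k)%N ->
     \rank ((A *m C) ^+ k) = \rank ((B *m A) ^+ k)).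
Proof.
split=> [sim k _ | rk]; first exact: simmx_rank_expr.
have [k rkk] := rank_expr_stable (A *m C).
exact: embeds_simmx rk (embeds_mulmx hABA rkk).
Qed.
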